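(* For all $n,d,k\in\mathbb{N}$, $T(n,\omega^d\cdot k)\ge P(n,\omega^d\cdot k)$. Consequently $T(n,\omega^d\cdot k)=P(n,\omega^d\cdot k)$.
   Context: $[c]=\{1,\dots,c\}$; ordinals are identified with sets of smaller ordinals; $\approx$ is order-equivalence; $\binom{S}{n}$ is the set of $n$-element subsets. $T(n,S)$ is the least $t\in\mathbb{N}$ such that for every $c\ge1$ and every $\mathrm{COL}:\binom{S}{n}\to[c]$ there is $S'\subseteq S$, $S'\approx S$, with $|\mathrm{COL}(\binom{S'}{n})|\le t$ ($\infty$ if none). Every $\beta<\omega^d\cdot k$ is uniquely $\omega^d b+\sum_{j<d}\omega^j a_j$ with $0\le b<k$, $a_j\in\mathbb{N}$. A coloring rule (CR) on $\binom{\omega^d\cdot k}{n}$ is a pair $(\mathcal{Y},\preceq)$ with $\mathcal{Y}:\{1,\dots,n\}\to\{0,\dots,k-1\}$ and $\preceq$ a total preorder on $I=\{(i,j):1\le i\le n,0\le j<d\}$ (with induced equivalence $\equiv$ and strict part $\prec$) such that: (1) if $d\ge1$, $(i,0)\prec(i',0)$ for $i<i'$; if $d=0$, $\mathcal{Y}(i)<\mathcal{Y}(i')$ for $i<i'$; (2) $(i,j)\equiv(i',j)$ for some $j$ implies $\mathcal{Y}(i)=\mathcal{Y}(i')$; (3) $(i,j)\prec(i,j')$ for $j>j'$; (4) $(i,j)\equiv(i',j')$ implies $j=j'$; (5) for $j>0$, $(i,j)\not\equiv(i',j)$ implies $(i,j-1)\not\equiv(i',j-1)$. $P(n,\omega^d\cdot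 k)$ is the total number of CRs on $\binom{\omega^d\cdot k}{n}$. *)

(* Defs.v *)
From mathcomp Require Import all_boot all_order.
From mathcomp Require Import finmap.
Set Implicit Arguments. Unset Strict Implicit. Unset Printing Implicit Defensive.
Local Open Scope fset_scope.

(* An ordinal beta = omega^d * b + sum_{j<d} omega^j a_j  (b < k) is
   represented by the list [:: b; a_(d-1); ...; a_1; a_0] of length d+1. *)
Definition inOrd (d k : nat) (s : seq nat) : bool :=
  (size s == d.+1) && (head 0 s < k).

(* The ordinal order: lexicographic comparison of Cantor normal-form
   coefficient lists (most significant first). *)
Fixpoint lexlt (s t : seq nat) : bool :=
  match s, t with
  | x :: s', y :: t' => (x < y) || ((x == y) && lexlt s' t')
  | _, _ => false
  end.

Definition ord_copy (d k : nat) (S' : seq nat -> Prop) : Prop :=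
  (forall x, S' x -> inOrd d k x) /\
  exists f : seq nat -> seq nat,
    (forall x, inOrd d k x -> S' (f x)) /\
    (forall x y, inOrd d k x -> inOrd d k y -> lexlt x y -> lexlt (f x) (f y)) /\
    (forall y, S' y -> exists x, inOrd d k x /\ f x = y).

(* "For every c >= 1 and every COL : [S]^n -> [c] there is S' ⊆ S, S' ≈ S,
   with |COL([S']^n)| <= t", for S = omega^d * k.  Colours [c] = {1..c} are
   relabelled as 'I_c = {0..c-1}; COL is a total function on finite sets of
   (codes of) ordinals, only its values on n-subsets of S matter. *)
Definition Tprop (n d k t : nat) : Prop :=
  forall c : nat, 0 < c ->
  forall COL : {fset (seq nat)} -> 'I_c,
  exists S' : seq nat -> Prop, ord_copy d k S' /\
    exists L : seq 'I_c, size L <= t /\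
      forall A : {fset (seq nat)}, #|` A| = n -> (forall x, x \in A -> S' x) ->
        COL A \in L.

(* Coloring rules.  Indices i in {1..n} are 'I_n (shifted by one), j in
   {0..d-1} are 'I_d; the total preorder on I = 'I_n * 'I_d is a boolean
   relation given as a finite function on pairs. *)
Definition CRtype (n d k : nat) : finType :=
  ({ffun 'I_n -> 'I_k} * {ffun ('I_n * 'I_d) * ('I_n * 'I_d) -> bool})%type.

Definition isCR (n d k : nat) (Y : {ffun 'I_n -> 'I_k})
  (R : {ffun ('I_n * 'I_d) * ('I_n * 'I_d) -> bool}) : bool :=
  let le x y := R (x, y) in
  let eqv x y := le x y && le y x in
  let lt x y := le x y && ~~ le y x in
  [forall x, forall y, le x y || le y x] &&
  [forall x, forall y, forall z, (le x y && le y z) ==> le x z] &&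
  (if 0 < d then
     [forall i : 'I_n, forall i' : 'I_n, forall j : 'I_d,
        ((i < i') && (val j == 0)) ==> lt (i, j) (i', j)]
   else [forall i : 'I_n, forall i' : 'I_n, (i < i') ==> (Y i < Y i')]) &&
  [forall i, forall i', forall j, eqv (i, j) (i', j) ==> (Y i == Y i')] &&
  [forall i, forall j : 'I_d, forall j' : 'I_d, (j' < j) ==> lt (i, j) (i, j')] &&
  [forall i, forall i', forall j, forall j', eqv (i, j) (i', j') ==> (j == j')] &&
  [forall i, forall i', forall j : 'I_d, forall j' : 'I_d,
     ((val j == (val j').+1) && ~~ eqv (i, j) (i', j)) ==> ~~ eqv (i, j') (i', j')].

Definition Pcount (n d k : nat) : nat :=
  #|[pred p : CRtype n d k | isCR p.1 p.2]|.

(* Main.v *)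
(* Lower bound: colour an n-set by the unique rule it realizes.  In every copy of
   omega^d * k each block contains a copy of omega^d, hence, as omega^(d+1) does
   not embed in omega^d, an infinitely branching tree of coefficients; choosing
   the coefficients class by class in the order of the preorder realizes every
   rule.  Upper bound: Ramsey's theorem for sequences of length n * d gives an
   infinite set of naturals on which the colour of a set depends only on the
   rule it realizes; a copy whose coefficients lie in this set, and are injective
   and increasing functions of the prefixes they end, has only n-subsets that
   realize rules. *)
Require Import Defs.
From mathcomp Require Import all_boot all_order.
From mathcomp Require Import finmap.
From mathcomp Require Import boolp zify.
Set Implicit Arguments. Unset Strict Implicit. Unset Printing Implicit Defensive.

(** * Infinite pigeonhole and Ramsey's theorem for increasing sequences of naturals *)

Lemma exists_fun X Y (P : X -> Y -> Prop) :
  (forall x, exists y, P x y) -> exists f, forall x, P x (f x).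
Proof. by move=> /choice[f]; exists f. Qed.

Lemma infinite_pigeonhole (C : finType) (u : nat -> C) :
  exists c, forall m, exists2 i, m <= i & u i = c.
Proof.
apply: contrapT => /forallNP H.
have /exists_fun[m Hm] c : exists m, forall i, m <= i -> u i <> c.
  move: (H c) => /existsNP[m Hm].
  by exists m => i mi uic; apply: Hm; exists i.
pose M := \max_c m c.
by apply: (Hm (u M) M) => //; exact: leq_bigmax.
Qed.

Lemma unbounded_enum (P : nat -> Prop) :
  (forall m, exists2 i, m <= i & P i) ->
  exists2 e : nat -> nat, {homo e : i j / i < j} & forall i, P (e i).
Proof.
move=> HP; have /exists_fun[nxt Hn] m : exists i, m <= i /\ P i.
  by have [i] := HP m; exists i.
pose fix e i := if i is i'.+1 then nxt (e i').+1 else nxt 0.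
exists e; last by case=> [|i]; apply: (Hn _).2.
by apply: homo_ltn => [? ? ?|i]; [exact: ltn_trans | exact: (Hn _).1].
Qed.

Lemma homo_ltn_mono (h : nat -> nat) :
  {homo h : i j / i < j} -> {mono h : i j / i < j}.
Proof.
move=> hh i j; apply/idP/idP => [|/hh//]; apply: contraTT.
by rewrite -!leqNgt leq_eqVlt => /orP[/eqP->//|/hh/ltnW].
Qed.

(** Induction on [N]: once a first term is fixed, the case [N] makes the colour of the rest constant
    on an infinite set. Repeating this in nested sets gives terms [a i] for which the colour depends
    only on the first index; pigeonhole removes that dependence. *)
Lemma ramsey (C : finType) N (chi : seq nat -> C) :
  exists (h : nat -> nat) (c : C), {homo h : i j / i < j} /\
    forall s, sorted ltn s -> size s = N -> chi (map h s) = c.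
Proof.
elim: N chi => [|N IH] chi.
  by exists id, (chi [::]); split=> // s _ /size0nil->.
have /exists_fun[step Hstep] (g : nat -> nat) : exists hc : (nat -> nat) * C,
    {homo hc.1 : i j / i < j} /\ forall s, sorted ltn s -> size s = N ->
      chi (g 0 :: map (fun i => g (hc.1 i).+1) s) = hc.2.
  have [h [c [hh Hc]]] := IH (fun s => chi (g 0 :: map (fun i => g i.+1) s)).
  by exists (h, c); split=> //= s ss sN; rewrite -(Hc s ss sN) -map_comp.
(* [G i] enumerates the set left after [i] rounds; a round drops the first element and thins the
   others by [step]. *)
pose fix G i := if i is i'.+1 then fun x => G i' ((step (G i')).1 x).+1 else id.
have GS i x : G i.+1 x = G i ((step (G i)).1 x).+1 by [].
have Ghomo i : {homo G i : x y / x < y}.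
  elim: i => [//|i IHi] x y xy; rewrite !GS; apply: (IHi).
  by rewrite ltnS; apply: (Hstep _).1.
pose a i := G i 0; pose u i := (step (G i)).2.
have ahomo : {homo a : i j / i < j}.
  apply: homo_ltn => [? ? ?|i]; first exact: ltn_trans.
  by rewrite /a GS; apply: Ghomo.
have Gsub i m : exists w : nat -> nat, forall x, G (m + i) x = G i (w x).
  elim: m => [|m [w Hw]]; first by exists id.
  by exists (fun x => w ((step (G (m + i))).1 x).+1) => x; rewrite addSn GS Hw.
have prehomog i s : sorted ltn s -> size s = N -> all (ltn i) s ->
    chi (a i :: map a s) = u i.
  move=> ss sN /allP si.
  have /exists_fun[t Ht] j : exists t, i < j -> a j = G i.+1 t.
    have [w Hw] := Gsub i.+1 (j - i.+1).
    by exists (w 0) => ij; rewrite -Hw subnK.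
  have -> : map a s = map (G i.+1) (map t s).
    by rewrite -map_comp; apply/eq_in_map => j /si /Ht.
  apply: (Hstep (G i)).2; last by rewrite size_map.
  rewrite sorted_map; apply: (sub_in_sorted (P := ltn i)) ss; last exact/allP.
  move=> x y ix iy /ahomo; rewrite !Ht //=.
  by rewrite (homo_ltn_mono (Ghomo i.+1)).
have [c Hc] := infinite_pigeonhole u; have [e ehomo ec] := unbounded_enum Hc.
exists (a \o e), c; split=> [x y /ehomo/ahomo//|[//|x s] /= xs [sN]].
rewrite (map_comp a e) prehomog ?size_map //.
  by rewrite sorted_map; apply: sub_sorted (path_sorted xs).
move: xs; rewrite (path_sortedE ltn_trans) => /andP[/allP xs _].
by rewrite all_map; apply/allP => y /xs /= /ehomo.
Qed.

(** * Order embeddings between finite powers of omega *)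

(** Lists of length [d] stand for the ordinals below omega^d, with no block number in front. *)
Definition ord_emb d m (g : seq nat -> seq nat) :=
  (forall s, size s = d -> size (g s) = m) /\
  (forall s t, size s = d -> size t = d -> lexlt s t -> lexlt (g s) (g t)).

Definition contains_copy d (X : seq nat -> Prop) :=
  exists2 g, ord_emb d d g & forall s, size s = d -> X (g s).

(** On nonempty lists of length [d] this is beta -> omega^(d-1) * t + beta, whose image is a final
    segment of omega^d. *)
Definition shift_head t (s : seq nat) := if s is x :: s' then t + x :: s' else [::].

Lemma size_shift_head t s : size (shift_head t s) = size s.
Proof. by case: s. Qed.

Lemma shift_head_lexlt c s t :
  lexlt s t -> lexlt (shift_head c s) (shift_head c t).
Proof. by case: s t => [|x s] [|y t] //=; rewrite ltn_add2l eqn_add2l. Qed.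

Lemma lexlt_head s t : lexlt s t -> head 0 s <= head 0 t.
Proof.
by case: s t => [|x s] [|y t] //= /orP[/ltnW//|/andP[/eqP->]].
Qed.

Lemma lexlt_behead s t :
  lexlt s t -> head 0 s = head 0 t -> lexlt (behead s) (behead t).
Proof.
by case: s t => [|x s] [|y t] //= /orP[xy exy|/andP[]//]; rewrite exy ltnn in xy.
Qed.

Lemma ord_emb_cons d m g c : ord_emb d.+1 m g -> ord_emb d m (fun s => g (c :: s)).
Proof.
case=> gs gl; split=> [s sd|s t sd td st]; first by apply: gs; rewrite /= sd.
by apply: gl => /=; rewrite ?sd ?td ?st ?eqxx ?orbT.
Qed.

(* The largest first coefficient attained by [g] is attained on a final
   segment, and a final segment of omega^d has order type omega^d. *)
Lemma head_stabilizes d m g M : ord_emb d m g ->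
    (forall s, size s = d -> head 0 (g s) <= M) ->
  exists a t, forall s, size s = d -> head 0 (g (shift_head t s)) = a.
Proof.
case=> _ gl gM; pose P a := `[< exists2 s, size s = d & head 0 (g s) = a >].
have exP : exists a, P a.
  by exists (head 0 (g (nseq d 0))); apply/asboolP; exists (nseq d 0);
    rewrite ?size_nseq.
have ubP a : P a -> a <= M by move=> /asboolP[s sd <-]; exact: gM.
case: (ex_maxnP exP ubP) => a /asboolP[s0 s0d <-] maxa.
exists (head 0 (g s0)), (head 0 s0).+1 => s sd; apply/eqP; rewrite eqn_leq.
have sd' : size (shift_head (head 0 s0).+1 s) = d by rewrite size_shift_head.
rewrite maxa /=; last by apply/asboolP; exists (shift_head (head 0 s0).+1 s).
case: s0 s s0d sd {maxa} sd' => [|x s0] [|y s] /= s0d sd sd'.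
- by [].
- by rewrite -s0d in sd.
- by rewrite -sd in s0d.
- by apply/lexlt_head/gl => //=; rewrite addSn ltnS leq_addr.
Qed.

Lemma ord_emb_behead d m g a t : ord_emb d m.+1 g ->
    (forall s, size s = d -> head 0 (g (shift_head t s)) = a) ->
  ord_emb d m (fun s => behead (g (shift_head t s))).
Proof.
move=> [gs gl] ga; split=> [s sd|s u sd ud su].
  by rewrite size_behead gs ?size_shift_head.
apply: lexlt_behead; last by rewrite !ga.
by apply: gl; rewrite ?size_shift_head //; apply: shift_head_lexlt.
Qed.

(** Induction on [d]: on lists headed by 0 the leading coefficients of the image are bounded by that
    of the image of 1, 0, ..., 0, so they stabilize; deleting the constant coefficient lowers both
    exponents by one. *)
Lemma ord_embNS d g : ~ ord_emb d.+1 d g.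
Proof.
elim: d g => [|d IH] g.
  case=> gs gl; have := gl [:: 0] [:: 1] erefl erefl erefl.
  by rewrite (size0nil (gs [:: 0] erefl)).
move=> gemb; have gl := gemb.2.
have g0 := ord_emb_cons 0 gemb.
have [s sd|a [t Ha]] := head_stabilizes (M := head 0 (g (1 :: nseq d.+1 0))) g0.
  by apply/lexlt_head/gl; rewrite /= ?size_nseq ?sd.
exact: IH (ord_emb_behead g0 Ha).
Qed.

(** If the stable coefficients were equal, the tails of [g] would embed omega^d in itself below a
    fixed [y]. Their leading coefficients would stabilize in turn, leaving an embedding that
    [ord_embNS] forbids; for [d = 0] nothing lies below [y]. *)
Lemma stable_head_lt d g g' a a' t t' :
    ord_emb d d.+1 g -> ord_emb d d.+1 g' ->
    (forall s s', size s = d -> size s' = d -> lexlt (g s) (g' s')) ->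
    (forall s, size s = d -> head 0 (g (shift_head t s)) = a) ->
    (forall s, size s = d -> head 0 (g' (shift_head t' s)) = a') ->
  a < a'.
Proof.
move=> ge ge' gg' ga ga'; pose z := nseq d 0; have zd : size z = d by rewrite size_nseq.
have aa' : a <= a'.
  by rewrite -(ga z zd) -(ga' z zd); apply/lexlt_head/gg'; rewrite size_shift_head.
rewrite ltn_neqAle aa' andbT; apply/eqP => eaa'.
pose y := behead (g' (shift_head t' z)).
have ly s : size s = d -> lexlt (behead (g (shift_head t s))) y.
  move=> sd; apply: lexlt_behead; first by apply: gg'; rewrite size_shift_head.
  by rewrite ga // ga'.
have Ge := ord_emb_behead ge ga.
case: d => [|d] in ge ge' gg' ga ga' z zd y ly Ge *.
  by have := ly [::] erefl; rewrite (size0nil (Ge.1 [::] erefl)).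
have [s /ly/lexlt_head//|b [u Hb]] := head_stabilizes (M := head 0 y) Ge.
exact: ord_embNS (ord_emb_behead Ge Hb).
Qed.

Lemma contains_copy_stable d (X : seq nat -> Prop) g a t : ord_emb d d.+1 g ->
    (forall s, size s = d -> X (g s)) ->
    (forall s, size s = d -> head 0 (g (shift_head t s)) = a) ->
  contains_copy d (fun s => X (a :: s)).
Proof.
move=> ge gX ga; exists (fun s => behead (g (shift_head t s))).
  exact: ord_emb_behead ge ga.
move=> s sd; have sd' : size (shift_head t s) = d by rewrite size_shift_head.
move: (gX _ sd') (ge.1 _ sd') (ga _ sd).
by case: (g _) => [|x u] //= + _ <-.
Qed.

(** Each [c] yields a copy of omega^d whose leading coefficients stabilize, being bounded by the
    image of the next copy. The stable values increase strictly with [c], so the one for [m] is at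
    least [m]. *)
Lemma contains_copy_cons d X m : contains_copy d.+1 X ->
  exists2 a, m <= a & contains_copy d (fun s => X (a :: s)).
Proof.
case=> g ge gX.
have gc c : ord_emb d d.+1 (fun s => g (c :: s)) by apply: ord_emb_cons.
have lt c c' s s' : c < c' -> size s = d -> size s' = d ->
    lexlt (g (c :: s)) (g (c' :: s')).
  by move=> cc' sd sd'; apply: ge.2; rewrite /= ?sd ?sd' ?cc'.
have ev c : exists a t, forall s, size s = d -> head 0 (g (c :: shift_head t s)) = a.
  apply: (head_stabilizes (M := head 0 (g (c.+1 :: nseq d 0))) (gc c)) => s sd.
  by apply/lexlt_head/lt; rewrite ?size_nseq.
suff [a ma [t Ht]] : exists2 a, m <= a &
    exists t, forall s, size s = d -> head 0 (g (m :: shift_head t s)) = a.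
  exists a => //; apply: (contains_copy_stable (gc m) _ Ht) => s sd.
  by apply: gX; rewrite /= sd.
elim: m => [|m [a ma [t Ht]]]; first by have [a Ha] := ev 0; exists a.
have [a' [t' Ht']] := ev m.+1; exists a'; last by exists t'.
apply: leq_ltn_trans ma _.
by apply: (stable_head_lt (gc m) (gc m.+1) _ Ht Ht') => s s'; apply: lt.
Qed.

(** The stable block numbers of the [k] blocks increase strictly and stay below [k], so a final
    segment of block [b] is sent into block [b]. *)
Lemma ord_copy_block d k S' b : ord_copy d k S' -> b < k ->
  contains_copy d (fun s => S' (b :: s)).
Proof.
case=> S'O [f [fS [flt _]]] bk.
have inO c s : c < k -> size s = d -> inOrd d k (c :: s).
  by rewrite /inOrd /= => -> ->; rewrite eqxx.
have fO x : inOrd d k x -> size (f x) = d.+1 /\ head 0 (f x) < k.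
  by move=> /fS/S'O/andP[/eqP].
have fc c : c < k -> ord_emb d d.+1 (fun s => f (c :: s)).
  move=> ck; split=> [s sd|s t sd td st]; first by have [] := fO _ (inO c s ck sd).
  by apply: flt; rewrite ?inO //= eqxx st orbT.
have lt c c' s s' : c < c' -> c' < k -> size s = d -> size s' = d ->
    lexlt (f (c :: s)) (f (c' :: s')).
  move=> cc' c'k sd sd'.
  by apply: flt; rewrite ?inO //= ?cc' // (ltn_trans cc').
have ev c : c < k ->
    exists a t, forall s, size s = d -> head 0 (f (c :: shift_head t s)) = a.
  move=> ck; apply: (head_stabilizes (M := k) (fc c ck)) => s sd.
  by have [_ /ltnW] := fO _ (inO c s ck sd).
have ge c : c < k -> forall a t,
    (forall s, size s = d -> head 0 (f (c :: shift_head t s)) = a) -> c <= a.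
  elim: c => [//|c IH] ck a t Ht; have ck' := ltnW ck.
  have [a' [t' Ht']] := ev c ck'; apply: leq_ltn_trans (IH ck' _ _ Ht') _.
  by apply: (stable_head_lt (fc c ck') (fc c.+1 ck) _ Ht' Ht) => s s'; apply: lt.
(* Downward induction from the last block: [e] counts the blocks after [c]. *)
have le e c : c + e.+1 = k -> forall a t,
    (forall s, size s = d -> head 0 (f (c :: shift_head t s)) = a) -> a <= c.
  elim: e c => [|e IH] c ek a t Ht; have ck : c < k by lia.
    have sd : size (shift_head t (nseq d 0)) = d by rewrite size_shift_head size_nseq.
    have [_] := fO _ (inO c _ ck sd); rewrite Ht ?size_nseq //; lia.
  have ck' : c.+1 < k by lia.
  have [a' [t' Ht']] := ev c.+1 ck'.
  have a'c : a' <= c.+1 by apply: (IH c.+1 _ _ _ Ht'); lia.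
  suff : a < a' by lia.
  by apply: (stable_head_lt (fc c ck) (fc c.+1 ck') _ Ht Ht') => s s'; apply: lt.
have [a [t Ht]] := ev b bk.
have ab : a = b.
  apply/eqP; rewrite eqn_leq (ge b bk _ _ Ht) andbT.
  by apply: (le (k - b.+1) b _ _ _ Ht); lia.
rewrite -ab; apply: (contains_copy_stable (fc b bk) _ Ht) => s sd.
exact/fS/inO.
Qed.

(** * Coloring rules in propositional form, and ranks in the preorder *)

Section Rules.
Variables n d k : nat.
Implicit Types (Y : {ffun 'I_n -> 'I_k})
  (R : {ffun ('I_n * 'I_d) * ('I_n * 'I_d) -> bool}).

(** By totality a strict comparison is the negation of the reverse one; [cr_up] is the
    contrapositive of condition (5). *)
Record coloring_rule Y R : Prop := ColoringRule {
  cr_total : forall x y, R (x, y) || R (y, x);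
  cr_trans : forall y x z, R (x, y) -> R (y, z) -> R (x, z);
  cr_last : forall (i i' : 'I_n) (j : 'I_d), i < i' -> val j = 0 ->
    ~~ R ((i', j), (i, j));
  cr_finite : d = 0 -> forall i i' : 'I_n, i < i' -> Y i < Y i';
  cr_block : forall i i' j, R ((i, j), (i', j)) -> R ((i', j), (i, j)) -> Y i = Y i';
  cr_desc : forall i (j j' : 'I_d), j' < j -> ~~ R ((i, j'), (i, j));
  cr_level : forall i i' j j', R ((i, j), (i', j')) -> R ((i', j'), (i, j)) -> j = j';
  cr_up : forall i i' (j j' : 'I_d), val j = j'.+1 ->
    R ((i, j'), (i', j')) -> R ((i', j'), (i, j')) ->
    R ((i, j), (i', j)) && R ((i', j), (i, j)) }.

Lemma isCRP Y R : reflect (coloring_rule Y R) (isCR Y R).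
Proof.
apply: (iffP idP).
  case/andP=> /andP[/andP[/andP[/andP[/andP[c1 c2] c3] c4] c5] c6] c7.
  have tot x y : R (x, y) || R (y, x) by move/forallP/(_ x)/forallP/(_ y): c1.
  split=> //.
  - move=> y x z xy yz; move/forallP/(_ x)/forallP/(_ y)/forallP/(_ z): c2.
    by rewrite xy yz.
  - move=> i i' j ii' j0; move: c3; rewrite (leq_trans _ (ltn_ord j)) //.
    move/forallP/(_ i)/forallP/(_ i')/forallP/(_ j).
    by rewrite ii' j0 eqxx => /andP[].
  - move=> d0 i i' ii'; move: c3; case: ifP => [d_gt0|_].
      by rewrite d0 in d_gt0.
    by move/forallP/(_ i)/forallP/(_ i'); rewrite ii'.
  - move=> i i' j ij ji; move/forallP/(_ i)/forallP/(_ i')/forallP/(_ j): c4.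
    by rewrite ij ji => /eqP.
  - move=> i j j' jj; move/forallP/(_ i)/forallP/(_ j)/forallP/(_ j'): c5.
    by rewrite jj => /andP[].
  - move=> i i' j j' ij ji; move/forallP/(_ i)/forallP/(_ i')/forallP/(_ j): c6.
    by move/forallP/(_ j'); rewrite ij ji => /eqP.
  - move=> i i' j j' jj ij ji; move/forallP/(_ i)/forallP/(_ i')/forallP/(_ j): c7.
    move/forallP/(_ j'); rewrite jj eqxx ij ji /=.
    by case: (_ && _).
case=> tot tr last fin block desc level up.
have lt x y : ~~ R (y, x) -> R (x, y) && ~~ R (y, x).
  by move=> yx; have := tot x y; rewrite (negPf yx) orbF => ->.
rewrite /isCR; do ![apply/andP; split].
- by apply/forallP => x; apply/forallP.
- apply/forallP => x; apply/forallP => y; apply/forallP => z.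
  by apply/implyP => /andP[]; apply: tr.
- case: ifPn => [_|]; last first.
    rewrite -eqn0Ngt => /eqP d0; apply/forallP => i; apply/forallP => i'.
    by apply/implyP; apply: fin.
  apply/forallP => i; apply/forallP => i'; apply/forallP => j.
  by apply/implyP => /andP[ii /eqP j0]; apply/lt/last.
- apply/forallP => i; apply/forallP => i'; apply/forallP => j.
  by apply/implyP => /andP[ij ji]; apply/eqP; apply: block ij ji.
- apply/forallP => i; apply/forallP => j; apply/forallP => j'.
  by apply/implyP => jj; apply/lt/desc.
- apply/forallP => i; apply/forallP => i'; apply/forallP => j; apply/forallP => j'.
  by apply/implyP => /andP[ij ji]; apply/eqP; apply: level ij ji.
- apply/forallP => i; apply/forallP => i'; apply/forallP => j; apply/forallP => j'.
  apply/implyP => /andP[/eqP jj]; apply: contra => /andP[ij ji].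
  exact: up ij ji.
Qed.

(** Counting the positions strictly below [x] turns the preorder into a comparison of naturals;
    values are skipped after classes with several members. *)
Definition rank R (x : 'I_n * 'I_d) := #|[set y | ~~ R (x, y)]|.

Lemma rank_le Y R x y : coloring_rule Y R -> R (x, y) = (rank R x <= rank R y).
Proof.
case=> tot tr _ _ _ _ _ _; apply/idP/idP => [xy|].
  apply/subset_leq_card/fintype.subsetP => z; rewrite !inE; apply: contra.
  exact: tr xy.
apply: contraLR => xy; rewrite -ltnNge; apply/proper_card/properP.
split; last by exists y; rewrite !inE // -[R _]orbb tot.
apply/fintype.subsetP => z; rewrite !inE; apply: contra => xz.
by apply: tr xz; have := tot x y; rewrite (negPf xy).
Qed.

Lemma cr_up_trans Y R i i' (j j' : 'I_d) : coloring_rule Y R -> j' <= j ->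
    R ((i, j'), (i', j')) -> R ((i', j'), (i, j')) ->
  R ((i, j), (i', j)) && R ((i', j), (i, j)).
Proof.
move=> cr; rewrite leq_eqVlt => /orP[/eqP/val_inj->-> //|].
case: j => j jd /=; elim: j => [//|j IH] in jd *.
rewrite ltnS leq_eqVlt => /orP[/eqP ej|lj] ij ji.
  by apply: (cr_up cr) ij ji; rewrite /= ej.
have /andP[ij' ji'] := IH (ltnW jd) lj ij ji.
exact: (cr_up cr) ij' ji'.
Qed.

End Rules.

(** * Ordinals given by coefficient functions, and sets realizing rules *)

(** Coefficients are listed by falling degree: that of omega^j has index [d - j], after the block
    number at index 0. *)
Definition elt d b (w : 'I_d -> nat) : seq nat :=
  b :: [seq w (rev_ord q) | q <- enum 'I_d].

Lemma size_elt d b (w : 'I_d -> nat) : size (elt b w) = d.+1.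
Proof. by rewrite /= size_map size_enum_ord. Qed.

Lemma nth_elt d b (w : 'I_d -> nat) (j : 'I_d) : nth 0 (elt b w) (d - j) = w j.
Proof.
have -> : d - j = (rev_ord j).+1 by rewrite /= subnSK.
have /= e := nth_ord_enum j (rev_ord j).
by rewrite /= (nth_map j) ?e ?rev_ordK // size_enum_ord (ltn_ord (rev_ord j)).
Qed.

Lemma last_elt0 d b (w : 'I_d -> nat) : d = 0 -> last 0 (elt b w) = b.
Proof. by move=> d0; rewrite -nth_last size_elt [d in d.+1.-1]d0. Qed.

Lemma last_elt d b (w : 'I_d -> nat) (j : 'I_d) :
  val j = 0 -> last 0 (elt b w) = w j.
Proof. by move=> j0; rewrite -nth_last size_elt -(nth_elt b w j) j0 subn0. Qed.

Lemma take_elt_rcons d b (w : 'I_d -> nat) (j : 'I_d) :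
  take (d - j).+1 (elt b w) = rcons (take (d - j.+1).+1 (elt b w)) (w j).
Proof.
rewrite subnSK // (take_nth 0) ?nth_elt //.
by rewrite size_elt ltnS leq_subr.
Qed.

Lemma eq_take_elt d b (w w' : 'I_d -> nat) m :
  (forall j : 'I_d, d - j <= m -> w j = w' j) ->
  take m.+1 (elt b w) = take m.+1 (elt b w').
Proof.
move=> ww'; apply: (@eq_from_nth _ 0) => [|p]; rewrite !size_take_min !size_elt //.
case: p => [//|p] plt.
have [pm pd] : p < m /\ d - p.+1 < d by move: plt; rewrite leq_min; lia.
have e : p.+1 = d - Ordinal pd by rewrite /= subKn //; lia.
by rewrite !nth_take ?ltnS // e !nth_elt; apply: ww'; rewrite -e.
Qed.

Section Realization.
Variables n d k : nat.
Implicit Types (p : CRtype n d k) (v : 'I_n * 'I_d -> nat).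

Definition realization p v := forall x y, p.2 (x, y) = (v x <= v y).

Definition elts p v := [seq elt (p.1 i) (fun j => v (i, j)) | i <- enum 'I_n].

Definition realizes p (A : {fset seq nat}) :=
  exists2 v, realization p v & A =i elts p v.

Lemma nth_elts p v (i : 'I_n) :
  nth [::] (elts p v) i = elt (p.1 i) (fun j => v (i, j)).
Proof. by rewrite (nth_map i) ?size_enum_ord // nth_ord_enum. Qed.

(** This is condition (1): [last 0] reads the coefficient of omega^0, or the block when [d = 0]. *)
Lemma sorted_elts p v : isCR p.1 p.2 -> realization p v ->
  sorted (relpre (last 0) ltn) (elts p v).
Proof.
move=> /isCRP cr pv; rewrite sorted_map.
have : sorted (relpre val ltn) (enum 'I_n).
  by rewrite -sorted_map val_enum_ord iota_ltn_sorted.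
apply: sub_sorted => i i' ii'.
change (last 0 (elt (p.1 i) (fun j => v (i, j))) <
        last 0 (elt (p.1 i') (fun j => v (i', j)))).
case: (posnP d) => [d0|d0]; first by rewrite !last_elt0 // (cr_finite cr).
rewrite !(last_elt _ _ (j := Ordinal d0)) //.
by rewrite ltnNge -pv (cr_last cr).
Qed.

(** Sorting by last entries recovers the list of elements from the set; blocks and coefficients are
    then read off, and the order of the coefficients is the preorder. *)
Lemma realizes_inj p q A : isCR p.1 p.2 -> isCR q.1 q.2 ->
  realizes p A -> realizes q A -> p = q.
Proof.
move=> pcr qcr [v pv Av] [w qw Aw].
have E : elts p v = elts q w.
  apply: (@irr_sorted_eq _ (relpre (last 0) ltn)).
  - by move=> x y z; apply: ltn_trans.
  - by move=> x /=; rewrite ltnn.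
  - exact: sorted_elts.
  - exact: sorted_elts.
  - by move=> x; rewrite -Av Aw.
have Ei i : elt (p.1 i) (fun j => v (i, j)) = elt (q.1 i) (fun j => w (i, j)).
  by rewrite -!nth_elts E.
have vw x : v x = w x.
  by case: x => i j; rewrite -(nth_elt (p.1 i) (fun j => v (i, j))) Ei nth_elt.
case: p q pv qw Ei {pcr qcr Av Aw E} => [Y R] [Y' R'] /= pv qw Ei.
congr (_, _); apply/ffunP; first by move=> i; apply/val_inj; case: (Ei i).
by move=> [x y]; rewrite pv qw /= !vw.
Qed.

Lemma card_realizes p A : isCR p.1 p.2 -> realizes p A -> #|` A| = n.
Proof.
move=> pcr [v pv Av]; have /sorted_uniq u := sorted_elts pcr pv.
transitivity (size (elts p v)); last by rewrite size_map size_enum_ord.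
apply/eqP; rewrite -uniq_size_uniq ?fset_uniq // u //.
- by move=> x y z; apply: ltn_trans.
- by move=> x /=; rewrite ltnn.
Qed.

(* The classes of the preorder receive their values in increasing order, each
   value exceeding all the earlier ones; a class sits at a single node of the
   tree of prefixes, all of whose coefficients have been chosen before. *)
Lemma realization_in (X : seq nat -> Prop) p : isCR p.1 p.2 ->
    (forall b, b < k -> contains_copy d (fun s => X (b :: s))) ->
  exists2 v, realization p v & forall i, X (elt (p.1 i) (fun j => v (i, j))).
Proof.
case: p => Y R /= /isCRP cr HX.
(* [pre v i j] is the node formed by the block and the coefficients of degree at least [j]; [good]
   asks for a copy of omega^j above it. *)
pose pre v i j := take (d - j).+1 (elt (Y i) (fun j => v (i, j))).
pose good v i j := contains_copy j (fun s => X (pre v i j ++ s)).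
have rk := rank_le _ _ cr.
(* Invariant: the classes of rank below [r] have received their values. *)
suff inv r : exists v,
    (forall x y, rank R x < r -> rank R y < r -> R (x, y) = (v x <= v y)) /\
    (forall i j, j <= d -> (forall j' : 'I_d, j <= j' -> rank R (i, j') < r) ->
      good v i j).
  have [v [vR vX]] := inv #|{: 'I_n * 'I_d}|.+1.
  have rlt x : rank R x < #|{: 'I_n * 'I_d}|.+1 by rewrite ltnS max_card.
  exists v => [x y|i]; first exact: vR.
  (* For [j = 0] the copy is a single point, the element itself. *)
  have [//|g [gs _] /(_ [::] erefl)] := vX i 0 (leq0n d).
  by rewrite (size0nil (gs [::] erefl)) /pre subn0 take_oversize ?size_elt // cats0.
elim: r => [|r [v [vR vX]]].
  exists (fun=> 0); split=> // i j; rewrite leq_eqVlt => /orP[/eqP->|jd] jr.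
    by rewrite /good /pre subnn /= take0; apply: HX.
  by have := jr (Ordinal jd) (leqnn _).
(* A rank skipped by the classes requires no new value. *)
case: (pselect (exists x0, rank R x0 = r)) => [[[i0 j0] r0]|nor]; last first.
  have ltr x : rank R x < r.+1 -> rank R x < r.
    by rewrite ltnS leq_eqVlt => /orP[/eqP xr|//]; case: nor; exists x.
  exists v; split=> [x y /ltr xr /ltr yr|i j jd jr]; first exact: vR.
  by apply: vX => // j' /jr/ltr.
have eqv x : rank R x = r -> R (x, (i0, j0)) && R ((i0, j0), x).
  by move=> xr; rewrite !rk xr r0 leqnn.
have above i (j : 'I_d) : rank R (i, j) = r -> forall j' : 'I_d, j < j' ->
    rank R (i, j') < r.
  by move=> <- j' jj; rewrite ltnNge -rk (cr_desc cr).
have [a aM Xa] : exists2 a, (\max_x v x).+1 <= a &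
    contains_copy j0 (fun s => X (pre v i0 j0.+1 ++ a :: s)).
  apply: (@contains_copy_cons j0 (fun s => X (pre v i0 j0.+1 ++ s))).
  apply: vX; first exact: ltn_ord.
  exact: above r0.
have va x : v x < a by apply: leq_trans aM; rewrite ltnS leq_bigmax.
pose v' x := if rank R x == r then a else v x.
have v'lt x : rank R x < r -> v' x = v x by rewrite /v' ltn_neqAle => /andP[/negPf->].
have v'eq x : rank R x = r -> v' x = a by rewrite /v' => ->; rewrite eqxx.
exists v'; split=> [x y|i j jd jr].
  rewrite !ltnS leq_eqVlt => /orP[/eqP xr|xr]; rewrite leq_eqVlt => /orP[/eqP yr|yr].
  - by rewrite rk xr yr !v'eq // !leqnn.
  - by rewrite rk xr v'eq // v'lt // leqNgt yr leqNgt va.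
  - by rewrite rk yr [v' y]v'eq // v'lt // (ltnW xr) (ltnW (va x)).
  - by rewrite !v'lt // vR.
case: (pselect (exists2 j' : 'I_d, j <= j' & rank R (i, j') = r)) => [[j' jj' j'r]|nor].
  (* The new class lies in the single degree [j0], and lower degrees at [i] rank above [r]; hence
     [j = j0]. *)
  have /andP[e1 e2] := eqv _ j'r; have ej := cr_level cr e1 e2; subst j'.
  have {jj'} ej : j = j0.
    apply/eqP; rewrite eqn_leq jj' leqNgt; apply/negP => jlt.
    have := jr (Ordinal (ltn_trans jlt (ltn_ord j0))) (leqnn _).
    by rewrite ltnS -j'r -rk (negPf (cr_desc cr _ _)).
  (* Equivalent positions share the block and all higher coefficients, so [i] sits at the node
     extended for [i0]. *)
  subst j; suff E : pre v' i j0 = rcons (pre v i0 j0.+1) a.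
    by case: Xa => g ge gX; exists g => // s sd; rewrite E cat_rcons; apply: gX.
  rewrite /pre take_elt_rcons v'eq // (cr_block cr e1 e2); congr rcons.
  apply: eq_take_elt => j'' le; have lj : j0 < j'' by have := ltn_ord j''; lia.
  rewrite v'lt; last exact: above j'r _ lj.
  have /andP[f1 f2] := cr_up_trans cr (ltnW lj) e1 e2.
  apply/eqP; rewrite eqn_leq -!vR ?f1 //; by [exact: above j'r _ lj|exact: above r0 _ lj].
have rlt (j' : 'I_d) : j <= j' -> rank R (i, j') < r.
  move=> jj'; have := jr j' jj'; rewrite ltnS leq_eqVlt => /orP[/eqP e|//].
  by case: nor; exists j'.
suff E : pre v' i j = pre v i j by rewrite /good E; apply: vX.
apply: eq_take_elt => j' le; rewrite v'lt // rlt //.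
by have := ltn_ord j'; lia.
Qed.

End Realization.

(** * Padding a finite family of naturals to an increasing sequence *)

Lemma index_sorted_leq v t : sorted leq t -> v \in t ->
  index v t = count (ltn^~ v) t.
Proof.
elim: t => [//|a t IH] /= at_; rewrite inE => vat.
move: (at_); rewrite (path_sortedE leq_trans) => /andP[/allP amin st].
case: (eqVneq a v) vat => [<- _|av /=].
  rewrite ltnn add0n; apply/esym/eqP; rewrite -leqn0 leqNgt -has_count.
  by apply/negP => /hasP[x /amin]; rewrite leqNgt => /negP.
by move=> vt; rewrite ltn_neqAle av amin // IH.
Qed.

(* Scaling by [#|I|.+1] leaves room to fill the gaps that [rank] skips after
   a class with several elements. *)
Lemma ltn_sorted_spread (I : finType) (V : I -> nat) :
  exists s, [/\ sorted ltn s, size s = #|I| &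
    forall x, nth 0 s #|[set y | V y < V x]| = #|I|.+1 * V x].
Proof.
pose t := sort leq [seq V x | x <- enum I].
have st : sorted leq t by apply: sort_sorted leq_total _.
have sizet : size t = #|I| by rewrite size_sort size_map -cardE.
(* Within a run of equal values the distance from its start is added; the first entry, at the index
   given by the rank, stays an exact multiple. *)
pose w r := #|I|.+1 * nth 0 t r + (r - index (nth 0 t r) t).
have whomo r r' : r < r' -> r' < #|I| -> w r < w r'.
  move=> rr r'I; have rI := ltn_trans rr r'I.
  have := sorted_leq_nth leq_trans leqnn 0 st r r'.
  rewrite !inE sizet rI r'I (ltnW rr) => /(_ isT isT isT).
  rewrite leq_eqVlt => /orP[/eqP e|lt].
    have := @index_nth _ 0 r t; rewrite sizet => /(_ rI).
    by move=> ir; rewrite /w -e ltn_add2l ltn_sub2rE.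
  rewrite /w; nia.
exists (map w (iota 0 #|I|)); split.
- rewrite sorted_map.
  apply: (sub_in_sorted (P := [pred i | i < #|I|])) (iota_ltn_sorted 0 #|I|).
    by move=> r r' _ r'I rr; apply: whomo.
  by apply/allP => r; rewrite mem_iota.
- by rewrite size_map size_iota.
move=> x; have xt : V x \in t by rewrite mem_sort map_f ?mem_enum.
have idx : index (V x) t = #|[set y | V y < V x]|.
  rewrite index_sorted_leq // (permP (permEl (perm_sort _ _))) count_map.
  rewrite -size_filter cardE /enum_mem -filter_predI; congr size.
  by apply: eq_filter => y; rewrite /= !inE andbT.
have ltI : #|[set y | V y < V x]| < #|I| by rewrite -idx -sizet index_mem.
rewrite (nth_map 0) ?size_iota // nth_iota // add0n /w -idx nth_index //.
by rewrite subnn addn0.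
Qed.

(** * A copy of omega^d * k whose n-subsets all realize rules *)

Lemma ltn_code_cons a s : CodeSeq.code s < CodeSeq.code (a :: s).
Proof. by rewrite /=; have := expn_gt0 2 a; nia. Qed.

Lemma ltn_code_head a b s : a < b -> CodeSeq.code (a :: s) < CodeSeq.code (b :: s).
Proof. by move=> ab; rewrite /= ltn_pmul2r // ltn_exp2l. Qed.

Lemma code_take_lt y p q : p < q -> q <= size y ->
  CodeSeq.code (rev (take p y)) < CodeSeq.code (rev (take q y)).
Proof.
elim: q => [//|q IH]; rewrite ltnS leq_eqVlt => /orP[/eqP<-|pq] qy.
  by rewrite (take_nth 0) // rev_rcons ltn_code_cons.
apply: ltn_trans (IH pq (ltnW qy)) _.
by rewrite (take_nth 0) // rev_rcons ltn_code_cons.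
Qed.

Lemma lexltP s t : size s = size t ->
  lexlt s t <-> exists p, [/\ p < size s, take p s = take p t & nth 0 s p < nth 0 t p].
Proof.
elim: s t => [|x s IH] [|y t] //=; first by split=> // -[p []].
case=> /IH{}IH; split=> [/orP[xy|/andP[/eqP-> /IH[p [ps e lt]]]]|].
- by exists 0.
- by exists p.+1; rewrite /= e.
- case=> -[|p] [] /=; first by move=> _ _ ->.
  by move=> ps [-> e] lt; rewrite eqxx; apply/orP; right; apply/IH; exists p.
Qed.

Section Spread.
Variables (d M : nat) (h : nat -> nat).
Hypotheses (M_gt0 : 0 < M) (h_homo : {homo h : i j / i < j}).

(** The prefix is reversed so that its code grows both when the prefix is extended and when its last
    entry increases. *)
Definition node (y : seq nat) (j : 'I_d) := CodeSeq.code (rev (take (d - j).+1 y)).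

(** Two coefficients coincide exactly when the prefixes they end do; the factor [M] leaves room for
    padding values. *)
Definition spread y := elt (head 0 y) (fun j => h (M * node y j)).

Lemma node_inj y z i j : size y = d.+1 -> size z = d.+1 ->
  node y i = node z j -> i = j /\ take (d - i).+1 y = take (d - i).+1 z.
Proof.
move=> yd zd /(can_inj CodeSeq.codeK)/(can_inj revK) e.
have ij : i = j.
  apply/val_inj; have := congr1 size e; rewrite !size_takel ?yd ?zd ?ltnS ?leq_subr //.
  by have := ltn_ord i; have := ltn_ord j; rewrite /=; lia.
by split=> //; rewrite e ij.
Qed.

Lemma spread_value_inj : injective (fun v => h (M * v)).
Proof.
have lt v w : v < w -> h (M * v) < h (M * w) by move=> vw; rewrite h_homo ?ltn_pmul2l.
by move=> v w e; case: (ltngtP v w) => // /lt; rewrite e ltnn.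
Qed.

(** The coefficient of degree 0 codes the entire list. *)
Lemma last_spread_inj y z : size y = d.+1 -> size z = d.+1 ->
  last 0 (spread y) = last 0 (spread z) -> y = z.
Proof.
move=> yd zd; case: (posnP d) => [d0|d0].
  rewrite !last_elt0 //; rewrite d0 in yd zd.
  by case: y yd => [|a []] // _; case: z zd => [|b []] //= _ ->.
rewrite !(last_elt _ _ (j := Ordinal d0)) // => /spread_value_inj /(node_inj yd zd)[_].
by rewrite subn0 !take_oversize ?yd ?zd.
Qed.

(** Before the first difference the images are determined by the common prefix; there the codes
    differ only through the last entry of the prefix. *)
Lemma spread_lexlt y z : size y = d.+1 -> size z = d.+1 ->
  lexlt y z -> lexlt (spread y) (spread z).
Proof.
move=> yd zd; rewrite !lexltP ?size_elt ?yd ?zd // => -[[|p] [pd e lt]].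
  by exists 0; split=> //; rewrite /= -!nth0.
have hd : head 0 y = head 0 z by case: y z {yd zd lt} e => [|a y] [|b z] // [].
exists p.+1; split=> //.
  rewrite /spread hd; apply: eq_take_elt => j jp; congr (h (M * _)).
  by rewrite /node -(take_takel y (jp : (d - j).+1 <= p.+1)) e take_takel.
have jd : d - p.+1 < d by lia.
have ej : p.+1 = d - Ordinal jd by rewrite /= subKn //; lia.
rewrite {1 2}ej !nth_elt /node -ej; apply: h_homo; rewrite ltn_pmul2l //.
rewrite (take_nth 0) ?yd // [take p.+2 z](take_nth 0) ?zd // !rev_rcons e.
exact: ltn_code_head.
Qed.

Lemma inOrd_spread k y : inOrd d k y -> inOrd d k (spread y).
Proof. by rewrite /inOrd size_elt eqxx => /andP[]. Qed.

Lemma ord_copy_spread k :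
  ord_copy d k (fun y => exists x, inOrd d k x /\ spread x = y).
Proof.
split; first by move=> _ [x [/inOrd_spread xO <-]].
exists spread; split=> [x xO|]; first by exists x.
split=> [x y /andP[/eqP xd _] /andP[/eqP yd _]|y [x xO]]; first exact: spread_lexlt.
by exists x.
Qed.

(** Sort [A] by last entries and compare prefix codes. Equal codes mean equal degree and prefix,
    which gives (2), (4) and (5); longer prefixes have larger codes, which gives (3); the sorting
    gives (1). *)
Lemma spread_realizes n k (A : {fset seq nat}) : #|` A| = n ->
    (forall x, x \in A -> exists y, inOrd d k y /\ spread y = x) ->
  exists (p : CRtype n d k) V, [/\ isCR p.1 p.2, realization p V &
    A =i elts p (fun x => h (M * V x))].
Proof.
move=> An AS; pose le := relpre (last 0) leq.
have le_tr : transitive le by move=> x y z; apply: leq_trans.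
pose s := sort le A.
have sA : s =i A by move=> x; rewrite mem_sort.
have sn : size s = n by rewrite size_sort -An.
have su : uniq s by rewrite sort_uniq fset_uniq.
have /exists_fun[y Hy] (i : 'I_n) : exists y, inOrd d k y /\ spread y = nth [::] s i.
  by apply: AS; rewrite -sA mem_nth ?sn.
have yd i : size (y i) = d.+1 by have [/andP[/eqP]] := Hy i.
have yk i : head 0 (y i) < k by have [/andP[]] := Hy i.
have ys i : spread (y i) = nth [::] s i by have [] := Hy i.
pose V (x : 'I_n * 'I_d) := node (y x.1) x.2.
pose p : CRtype n d k := ([ffun i => Ordinal (yk i)], [ffun xy => V xy.1 <= V xy.2]).
have last_lt (i i' : 'I_n) : i < i' -> last 0 (spread (y i)) < last 0 (spread (y i')).
  move=> ii'; rewrite ltn_neqAle; apply/andP; split.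
    apply/eqP => /(last_spread_inj (yd i) (yd i')) /(congr1 spread).
    by rewrite !ys => /eqP; rewrite nth_uniq ?sn // => /eqP e; rewrite e ltnn in ii'.
  rewrite !ys; apply: (sorted_ltn_nth le_tr [::]); rewrite ?inE ?sn //.
  by apply: sort_sorted => x z; apply: leq_total.
have eqV x x' : p.2 (x, x') -> p.2 (x', x) -> V x = V x'.
  by rewrite !ffunE /= => l1 l2; apply/eqP; rewrite eqn_leq l1.
have Vtake i j i' j' : V (i, j) = V (i', j') ->
    j = j' /\ take (d - j).+1 (y i) = take (d - j).+1 (y i').
  exact: node_inj.
exists p, V; split.
- apply/isCRP; split.
  + by move=> x x'; rewrite !ffunE leq_total.
  + by move=> x' x x''; rewrite !ffunE; apply: leq_trans.
  + move=> i i' j /last_lt + j0.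
    by rewrite !(last_elt _ _ j0) (homo_ltn_mono h_homo) ltn_pmul2l // ffunE -ltnNge.
  + by move=> d0 i i' /last_lt; rewrite !last_elt0 // !ffunE.
  + move=> i i' j l1 l2; have [_] := Vtake _ _ _ _ (eqV _ _ l1 l2).
    move=> e; rewrite !ffunE; apply/val_inj => /=.
    by have := congr1 (head 0) e; case: (y i) (y i') => [|? ?] [|? ?].
  + move=> i j j' jj; rewrite ffunE /= -ltnNge; apply: code_take_lt; rewrite ?yd.
      by have := ltn_ord j; rewrite /=; lia.
    by rewrite ltnS leq_subr.
  + by move=> i i' j j' l1 l2; have [] := Vtake _ _ _ _ (eqV _ _ l1 l2).
  + move=> i i' j j' jj l1 l2; have [_ e] := Vtake _ _ _ _ (eqV _ _ l1 l2).
    suff E : V (i, j) = V (i', j) by rewrite !ffunE /= E leqnn.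
    rewrite /V /node /=.
    have le' : (d - j).+1 <= (d - j').+1 by rewrite jj; lia.
    by rewrite -(take_takel (y i) le') e take_takel.
- by move=> x x'; rewrite ffunE.
move=> x; rewrite -sA; congr (x \in _); apply: (@eq_from_nth _ [::]).
  by rewrite sn size_map size_enum_ord.
move=> i; rewrite sn => i_n.
have := nth_elts p (fun x => h (M * V x)) (Ordinal i_n); rewrite /= => ->.
by rewrite -(ys (Ordinal i_n)) /spread ffunE.
Qed.

End Spread.

(** * The upper and lower bounds *)

Lemma Tprop_Pcount n d k : Tprop n d k (Pcount n d k).
Proof.
move=> c _ COL; pose N := #|{: 'I_n * 'I_d}|.
(* One colour of [s] records, for all [p] at once, the colour of the set whose coefficient at [x] is
   the entry of [s] of index [rank p.2 x]. *)
pose chi s : {ffun CRtype n d k -> 'I_c} :=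
  [ffun p => COL (seq_fset tt (elts p (fun x => nth 0 s (rank p.2 x))))].
have [h [u [hh Hu]]] := ramsey N chi.
(* The factor [N.+1] is the scaling of [ltn_sorted_spread]. *)
exists (fun y => exists x, inOrd d k x /\ spread d N.+1 h x = y).
split; first exact: ord_copy_spread.
exists [seq u p | p : CRtype n d k in [pred p | isCR p.1 p.2]].
split=> [|A An AS]; first by rewrite size_image.
have [p [V [pcr pV AV]]] := spread_realizes (ltn0Sn N) hh An AS.
have [s [ss sN sV]] := ltn_sorted_spread V.
have rankV x : rank p.2 x = #|[set y | V y < V x]|.
  by apply: eq_card => y; rewrite !inE pV ltnNge.
have ltN x : #|[set y | V y < V x]| < size s.
  rewrite sN -cardsT; apply/proper_card/properP; split; first exact: subsetT.
  by exists x; rewrite !inE // ltnn.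
suff -> : COL A = u p by apply: image_f.
rewrite -(Hu s ss sN) ffunE; congr COL; apply/fsetP => x.
rewrite AV seq_fsetE; congr (x \in _); apply: eq_map => i; congr elt.
by apply/funext => j; rewrite rankV (nth_map 0) // sV.
Qed.

(** Colour a set by the rule it realizes: any copy contains a set realizing each rule, so [L]
    contains [Pcount] distinct colours. *)
Lemma Pcount_le n d k t : Tprop n d k t -> Pcount n d k <= t.
Proof.
move=> HT; have [->//|P0] := posnP (Pcount n d k).
case/card_gt0P: P0 => p0 _.
(* [p0] is the default for sets that realize no rule; its existence also makes the number of colours
   positive. *)
pose typ A := odflt p0 [pick p : CRtype n d k | isCR p.1 p.2 && `[< realizes p A >]].
have typE p A : isCR p.1 p.2 -> realizes p A -> typ A = p.
  move=> pcr pA; rewrite /typ; case: pickP => [q /andP[qcr /asboolP qA]|/(_ p)].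
    exact: realizes_inj qA pA.
  by rewrite pcr (asboolT pA).
have [|S' [copy [L [Lt HL]]]] := HT #|CRtype n d k| _ (fun A => enum_rank (typ A)).
  by apply/card_gt0P; exists p0.
apply: leq_trans Lt; rewrite /Pcount -(card_image (@enum_rank_inj _)).
apply: leq_trans (card_size L); apply/subset_leq_card/fintype.subsetP => r.
case/imageP => p pcr ->; rewrite inE in pcr.
have [v pv vS] := realization_in pcr (fun b => ord_copy_block copy).
pose A := seq_fset tt (elts p v).
have pA : realizes p A by exists v => // x; rewrite seq_fsetE.
rewrite -(typE _ _ pcr pA); apply: HL; first exact: card_realizes pcr pA.
by move=> x; rewrite seq_fsetE => /mapP[i _ ->].
Qed.

(* T(n, omega^d*k) >= P(n, omega^d*k) (every admissible t is >= P), and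
   consequently T = P (P itself is admissible, hence the least one). *)
Theorem theorem9p4 (n d k : nat) :
  (forall t : nat, Tprop n d k t -> Pcount n d k <= t) /\
  Tprop n d k (Pcount n d k).
Proof. by split=> [t|]; [exact: Pcount_le | exact: Tprop_Pcount]. Qed.
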